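(* Let $(A,[\cdot,\cdot])$ be a left-Alia algebra and $r=\sum_i u_i\otimes v_i\in A\otimes A$. Let $h:A\to\mathrm{End}(A\otimes A)$ be the linear map $$h(x)=(\mathcal R-\mathcal L)(x)\otimes\mathrm{id}-\mathrm{id}\otimes\mathcal R(x),\qquad x\in A,$$ and define the co-multiplication $\delta_r:A\to A\otimes A$ by $\delta_r(x)=h(x)r$ for all $x\in A$. (a) For all $x\in A$, the identity $$(\mathrm{id}^{\otimes 3}+\xi+\xi^2)(\tau\otimes\mathrm{id}-\mathrm{id}^{\otimes 3})(\delta_r\otimes\mathrm{id})\delta_r(x)=0$$ holds if and only if $$(\mathrm{id}^{\otimes 3}+\xi+\xi^2)\Big(\big(\mathrm{id}\otimes\mathrm{id}\otimes\mathcal R(x)\big)(\mathrm{id}\otimes\tau)\mathrm{Al}(r)+\sum_j\Big[h([u_j,x]-[x,u_j])\big(r+\tau(r)\big)\otimes v_j+\tau h(u_j)\big(r+\tau(r)\big)\otimes[v_j,x]$$ $$+v_j\otimes\big(\mathcal R(u_j)\otimes\mathrm{id}\big)h(x)\big(r+\tau(r)\big)+\big(\mathrm{id}\otimes\mathcal R(v_j)\otimes\mathcal R(x)\big)\big(u_j\otimes(r+\tau(r))\big)+\big(\mathrm{id}\otimes\mathcal R(u_j)\otimes\mathcal R(x)\big)\big(v_j\otimes(r+\tau(r))\big)\Big]\Big)=0.$$ (b) For all $x,y\in A$, the identity $$(\tau-\mathrm{id}^{\otimes 2})\Big(\delta_r([x,y]-[y,x])+(\mathcal R(x)\otimes\mathrm{id})\delta_r(y)-(\mathcal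 R(y)\otimes\mathrm{id})\delta_r(x)\Big)=0$$ holds if and only if $$\tau h([x,y]-[y,x])\big(r+\tau(r)\big)-\big(\mathrm{id}\otimes\mathcal R(y)\big)\tau h(x)\big(r+\tau(r)\big)+\big(\mathrm{id}\otimes\mathcal R(x)\big)\tau h(y)\big(r+\tau(r)\big)=0.$$
   Context: All vector spaces are finite-dimensional over an algebraically closed field $\mathbb K$ of characteristic zero. A left-Alia algebra is a vector space $A$ with a bilinear map $[\cdot,\cdot]:A\times A\to A$ (not assumed antisymmetric) such that for all $x,y,z\in A$ $$[[x,y],z]+[[y,z],x]+[[z,x],y]=[[y,x],z]+[[z,y],x]+[[x,z],y].$$ $\mathcal L,\mathcal R:A\to\mathrm{End}(A)$ are the left and right multiplications: $\mathcal L(x)y=[x,y]=\mathcal R(y)x$. The maps $\tau:A\otimes A\to A\otimes A$ and $\xi:A^{\otimes3}\to A^{\otimes 3}$ are the linear maps with $\tau(x\otimes y)=y\otimes x$ and $\xi(x\otimes y\otimes z)=y\otimes z\otimes x$. For $r=\sum_i u_i\otimes v_i\in A\otimes A$, $$\mathrm{Al}(r)=\sum_{i,j}\Big([u_i,u_j]\otimes v_i\otimes v_j+u_i\otimes([u_j,v_i]-[v_i,u_j])\otimes v_j-u_i\otimes u_j\otimes[v_j,v_i]\Big)\in A\otimes A\otimes A.$$ *)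

(* Defs.v *)
From HB Require Import structures.
From mathcomp Require Import all_boot all_order all_algebra.

Set Implicit Arguments.
Unset Strict Implicit.
Unset Printing Implicit Defensive.

Import GRing.Theory.
Local Open Scope ring_scope.

Reserved Notation "u \ox v" (at level 40, left associativity).
Reserved Notation "f \oxm g" (at level 40, left associativity).

(* The tensor product of finite-dimensional spaces, in coordinates: the matrix
   M : tens U V stands for \sum_(i, j) M i j *: (e_i \ox f_j), where e and f are
   the bases [vbasis fullv] of U and V. The lemmas [tlift_tensv] and [tens_ext]
   are its universal property. *)
Section TensorProduct.
Variable K : fieldType.

Definition tens (U V : vectType K) : Type :=
  'M[K]_(\dim {:U}, \dim {:V}).
HB.instance Definition _ (U V : vectType K) := Vector.on (tens U V).

Section Two.
Variables U V W : vectType K.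

Definition tensv (u : U) (v : V) : tens U V :=
  \matrix_(i, j) (coord (vbasis fullv) i u * coord (vbasis fullv) j v).

Definition tlift_fun (b : U -> V -> W) (M : tens U V) : W :=
  \sum_i \sum_j M i j *: b (vbasis fullv)`_i (vbasis fullv)`_j.

Fact tlift_fun_is_linear b : linear (tlift_fun b).
Proof.
move=> a M N; rewrite /tlift_fun scaler_sumr -big_split /=.
apply: eq_bigr => i _; rewrite scaler_sumr -big_split /=.
by apply: eq_bigr => j _; rewrite !mxE scalerDl scalerA.
Qed.
HB.instance Definition _ b := GRing.isLinear.Build K (tens U V) W _
  (tlift_fun b) (tlift_fun_is_linear b).

(* Meaningful when b is bilinear, see [tlift_tensv]. *)
Definition tlift (b : U -> V -> W) : 'Hom(tens U V, W) := linfun (tlift_fun b).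

End Two.
End TensorProduct.

Notation "u \ox v" := (tensv u v) : ring_scope.

Section TensorTheory.
Variable K : fieldType.
Implicit Types U V W : vectType K.

Lemma tensvPl U V (v : V) : linear (fun u : U => u \ox v).
Proof. by move=> a x y; apply/matrixP=> i j; rewrite !mxE linearP mulrDl mulrA. Qed.

Lemma tensvPr U V (u : U) : linear (fun v : V => u \ox v).
Proof.
by move=> a x y; apply/matrixP=> i j; rewrite !mxE linearP mulrDr mulrCA.
Qed.

Lemma tlift_tensv U V W (b : U -> V -> W) :
    (forall v, linear (b^~ v)) -> (forall u, linear (b u)) ->
  forall u v, tlift b (u \ox v) = b u v.
Proof.
move=> bl br u v; rewrite lfunE /= /tlift_fun.
pose Fr x : {linear V -> W} :=
  HB.pack (b x) (GRing.isLinear.Build K V W _ (b x) (br x)).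
pose Fl y : {linear U -> W} :=
  HB.pack (b^~ y) (GRing.isLinear.Build K U W _ (b^~ y) (bl y)).
have eu := coord_vbasis (memvf u); have ev := coord_vbasis (memvf v).
have -> : b u v = Fl v u by [].
rewrite [in RHS]eu linear_sum /=; apply: eq_bigr => i _.
transitivity (coord (vbasis fullv) i u *: Fl v (vbasis fullv)`_i);
  last by rewrite -linearZ.
have -> : Fl v (vbasis fullv)`_i = Fr (vbasis fullv)`_i v by [].
rewrite [in RHS]ev linear_sum scaler_sumr /=; apply: eq_bigr => j _.
by rewrite -[RHS]/(_ *: Fr (vbasis fullv)`_i _) linearZ /= mxE scalerA.
Qed.

Lemma tens_sum U V (M : tens U V) :
  M = \sum_i \sum_j M i j *: ((vbasis fullv)`_i \ox (vbasis fullv)`_j).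
Proof.
have cE X (k l : 'I_(\dim {:X})) :
    coord (vbasis fullv) k (vbasis (@fullv K X))`_l = (k == l)%:R.
  by rewrite coord_free ?(basis_free (vbasisP _)) // eq_sym.
apply/matrixP => i j; rewrite summxE (bigD1 i) //= summxE (bigD1 j) //=.
rewrite !mxE !cE !eqxx !mulr1 !big1 ?addr0 // => [k /negPf ki|k /negPf kj].
  by rewrite summxE big1 // => l _; rewrite !mxE !cE eq_sym ki mul0r mulr0.
by rewrite !mxE !cE [j == k]eq_sym kj !mulr0.
Qed.

Lemma tens_ext U V W (f g : 'Hom(tens U V, W)) :
  (forall u v, f (u \ox v) = g (u \ox v)) -> f = g.
Proof.
move=> fg; apply/lfunP => M; rewrite (tens_sum M) !linear_sum /=.
apply: eq_bigr => i _; rewrite !linear_sum /=.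
by apply: eq_bigr => j _; rewrite !linearZ /= fg.
Qed.

End TensorTheory.

Section TensorMaps.
Variable K : fieldType.

Definition tmap (U V U' V' : vectType K) (f : 'Hom(U, U')) (g : 'Hom(V, V')) :
    'Hom(tens U V, tens U' V') :=
  tlift (fun u v => f u \ox g v).

Definition tswap (U V : vectType K) : 'Hom(tens U V, tens V U) :=
  tlift (fun u v => v \ox u).

Definition tassoc (U V W : vectType K) :
    'Hom(tens (tens U V) W, tens U (tens V W)) :=
  tlift (fun s w => tlift (fun u v => u \ox (v \ox w)) s).

Definition tassocV (U V W : vectType K) :
    'Hom(tens U (tens V W), tens (tens U V) W) :=
  tlift (fun u s => tlift (fun v w => (u \ox v) \ox w) s).

End TensorMaps.

Notation "f \oxm g" := (tmap f g) : ring_scope.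

Section TensorMapsTheory.
Variable K : fieldType.
Implicit Types U V W : vectType K.

Lemma tmapE U V U' V' (f : 'Hom(U, U')) (g : 'Hom(V, V')) u v :
  (f \oxm g) (u \ox v) = f u \ox g v.
Proof.
rewrite tlift_tensv // => [y|x] a s t.
  by rewrite linearP tensvPl.
by rewrite linearP tensvPr.
Qed.

Lemma tswapE U V (u : U) (v : V) : tswap U V (u \ox v) = v \ox u.
Proof.
by rewrite tlift_tensv // => x a s t; rewrite ?tensvPr ?tensvPl.
Qed.

Lemma tassocE U V W (u : U) (v : V) (w : W) :
  tassoc U V W ((u \ox v) \ox w) = u \ox (v \ox w).
Proof.
have H z (x : U) (y : V) : tlift (fun u v => u \ox (v \ox z)) (x \ox y)
    = x \ox (y \ox z) :> tens U (tens V W).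
  rewrite tlift_tensv // => [v'|u'] a s t; first by rewrite tensvPl.
  by rewrite tensvPl tensvPr.
rewrite tlift_tensv ?H // => [y|s] a x t; first by rewrite linearP.
rewrite (tens_sum s) !linear_sum /= -big_split; apply: eq_bigr => i _ /=.
rewrite !linear_sum /= -big_split; apply: eq_bigr => j _ /=.
by rewrite !linearZ /= !H !tensvPr !scalerDr !scalerA mulrC.
Qed.

Lemma tassocVE U V W (u : U) (v : V) (w : W) :
  tassocV U V W (u \ox (v \ox w)) = (u \ox v) \ox w.
Proof.
have H z (x : V) (y : W) : tlift (fun v w => (z \ox v) \ox w) (x \ox y)
    = (z \ox x) \ox y :> tens (tens U V) W.
  rewrite tlift_tensv // => [v'|u'] a s t; first by rewrite tensvPr tensvPl.
  by rewrite tensvPr.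
rewrite tlift_tensv ?H // => [s|y] a x t; last by rewrite linearP.
rewrite (tens_sum s) !linear_sum /= -big_split; apply: eq_bigr => i _ /=.
rewrite !linear_sum /= -big_split; apply: eq_bigr => j _ /=.
by rewrite !linearZ /= !H !tensvPl !scalerDr !scalerA mulrC.
Qed.

End TensorMapsTheory.

Section LeftAlia.
Variables (K : fieldType) (A : vectType K) (br : {bilinear A -> A -> A}).

Definition left_alia : Prop := forall x y z : A,
  br (br x y) z + br (br y z) x + br (br z x) y =
  br (br y x) z + br (br z y) x + br (br x z) y.

Definition lmul (x : A) : 'End(A) := linfun (br x).
Definition rmul (y : A) : 'End(A) := linfun (applyr br y).

Lemma lmulE x y : lmul x y = br x y. Proof. by rewrite lfunE. Qed.
Lemma rmulE x y : rmul y x = br x y. Proof. by rewrite lfunE. Qed.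

(* A^{\otimes 3} is bracketed to the left. *)
Definition tens2 : vectType K := tens A A.
Definition tens3 : vectType K := tens tens2 A.

Definition tau : 'End(tens2) := tswap A A.
Definition id_tau : 'End(tens3) :=
  (tassocV A A A \o (\1%VF \oxm tau) \o tassoc A A A)%VF.

Definition xi : 'End(tens3) := (tswap A tens2 \o tassoc A A A)%VF.

Lemma xiE x y z : xi (x \ox y \ox z) = y \ox z \ox x.
Proof. by rewrite comp_lfunE tassocE tswapE. Qed.

Lemma id_tauE x y z : id_tau (x \ox y \ox z) = x \ox z \ox y.
Proof. by rewrite !comp_lfunE tassocE tmapE tswapE tassocVE id_lfunE. Qed.

Definition cyc : 'End(tens3) := \1%VF + xi + (xi \o xi)%VF.

Definition hmap (x : A) : 'End(tens2) :=
  (rmul x - lmul x) \oxm \1%VF - \1%VF \oxm rmul x.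

Lemma hmapE x u v :
  hmap x (u \ox v) = (br u x - br x u) \ox v - u \ox br v x.
Proof.
rewrite /hmap add_lfunE opp_lfunE !tmapE !id_lfunE add_lfunE opp_lfunE.
by rewrite !rmulE lmulE.
Qed.

Fact hmap_is_linear : linear hmap.
Proof.
move=> a x y; apply: tens_ext => u v.
rewrite !hmapE [RHS]add_lfunE scale_lfunE !hmapE !linearPr linearPl /=.
have -> : a *: br u x + br u y - (a *: br x u + br y u) =
          a *: (br u x - br x u) + (br u y - br y u).
  by rewrite opprD addrACA scalerBr.
by rewrite tensvPl tensvPr opprD addrACA scalerBr.
Qed.
HB.instance Definition _ := GRing.isLinear.Build K A 'End(tens2) _
  hmap hmap_is_linear.

Definition delta_fun (r : tens2) (x : A) : tens2 := hmap x r.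
Fact delta_fun_is_linear r : linear (delta_fun r).
Proof. by move=> a x y; rewrite /delta_fun linearP add_lfunE scale_lfunE. Qed.
HB.instance Definition _ r := GRing.isLinear.Build K A tens2 _
  (delta_fun r) (delta_fun_is_linear r).

Definition delta (r : tens2) : 'Hom(A, tens2) := linfun (delta_fun r).

Lemma deltaE r x : delta r x = hmap x r. Proof. by rewrite lfunE. Qed.

Definition Al (n : nat) (u v : 'I_n -> A) : tens3 :=
  \sum_i \sum_j
    (br (u i) (u j) \ox v i \ox v j
     + u i \ox (br (u j) (v i) - br (v i) (u j)) \ox v j
     - u i \ox u j \ox br (v j) (v i)).

End LeftAlia.

Arguments tau {K A}.
Arguments id_tau {K A}.
Arguments xi {K A}.
Arguments cyc {K A}.

(* Main.v *)
Require Import Defs.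
From HB Require Import structures.
From mathcomp Require Import all_boot all_order all_algebra.
From mathcomp Require Import ring.

Set Implicit Arguments.
Unset Strict Implicit.
Unset Printing Implicit Defensive.

Import GRing.Theory.
Local Open Scope ring_scope.

(** In both parts the two sides of the equivalence are equal up to a sign, so
one vanishes exactly when the other does. Write {x, y} for the commutator
[x, y] - [y, x]; the left-Alia law says that the cyclic sum of [{x, y}, z] is 0.

For part (b), let E = [compat] x y be the endomorphism of A (x) A whose value at
r is the tensor inside (tau - id). The left-Alia law turns E (a (x) b) into an
expression that changes sign when a and b, and the two slots, are exchanged
([compatE]). So E anticommutes with tau, and (tau - id) E r equals
tau E (r + tau r), which is the right-hand side of (b).

Part (a) is quadratic in r. Both sides are sums, over two indices i and j, of
contributions of the pair (u_i (x) v_i, u_j (x) v_j): [coJacobi_term] on the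
left, [Al_term] and [symmetric_term] on the right. For a single pair the cyclic
sums of the two contributions are not opposite. After one use of the left-Alia
law (on v_i, u_j, x), their total is the cyclic sum of a tensor
[residue] (i, j) minus that of the tensor with i and j exchanged; this is
[pair_defect]. Such a difference dies in the sum over all pairs, hence the two
sides of (a) are opposite.

The identity [pair_defect] compares explicit sums of pure tensors and is checked
coefficient by coefficient: a fixed entry of a pure tensor is a
multilinear form with values in K, so after multilinear expansion what remains
is an identity in the commutative ring K. *)

(** * Additivity of tensors and of linear maps *)

Section Tensv.
Variables (K : fieldType) (U V : vectType K).

Fact tensv_is_bilinear : bilinear_for *:%R *:%R (@tensv K U V).
Proof. by split=> y a s t; [exact: tensvPl | exact: tensvPr]. Qed.
HB.instance Definition _ :=
  bilinear_isBilinear.Build K U V (tens U V) _ _ (@tensv K U V)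
    tensv_is_bilinear.

Lemma tensvDl (s t : U) (w : V) : (s + t) \ox w = s \ox w + t \ox w.
Proof. exact: linearDl. Qed.
Lemma tensvDr (w : U) (s t : V) : w \ox (s + t) = w \ox s + w \ox t.
Proof. exact: linearDr. Qed.
Lemma tensvBl (s t : U) (w : V) : (s - t) \ox w = s \ox w - t \ox w.
Proof. exact: linearBl. Qed.
Lemma tensvBr (w : U) (s t : V) : w \ox (s - t) = w \ox s - w \ox t.
Proof. exact: linearBr. Qed.
Lemma tensvNl (s : U) (w : V) : - s \ox w = - (s \ox w).
Proof. exact: linearNl. Qed.
Lemma tensvNr (w : U) (s : V) : w \ox - s = - (w \ox s).
Proof. exact: linearNr. Qed.
Lemma tensv0r (w : U) : w \ox (0 : V) = 0.
Proof. by rewrite -(subrr (0 : V)) tensvBr subrr. Qed.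

Lemma lfunDr (f : 'Hom(U, V)) (s t : U) : f (s + t) = f s + f t.
Proof. exact: linearD. Qed.
Lemma lfunBr (f : 'Hom(U, V)) (s t : U) : f (s - t) = f s - f t.
Proof. exact: linearB. Qed.
Lemma lfunNr (f : 'Hom(U, V)) (s : U) : f (- s) = - f s.
Proof. exact: linearN. Qed.

End Tensv.

Lemma morphD_sum (M N : zmodType) (f : M -> N) (n : nat) (E : 'I_n -> M) :
  {morph f : s t / s + t} -> f (\sum_i E i) = \sum_i f (E i).
Proof.
move=> fD; apply: (big_morph f fD); apply: (addrI (f 0)).
by rewrite -fD !addr0.
Qed.

Section AliaCoalgebra.
Variables (K : fieldType) (A : vectType K) (br : {bilinear A -> A -> A}).
Hypothesis brA : left_alia br.
Local Notation h := (hmap br).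
Local Notation R := (rmul br).
Local Notation V3 := (tens3 A).
Local Notation comm x y := (br x y - br y x).

Lemma brDl x y z : br (x + y) z = br x z + br y z. Proof. exact: linearDl. Qed.
Lemma brDr x y z : br x (y + z) = br x y + br x z. Proof. exact: linearDr. Qed.
Lemma brNl x z : br (- x) z = - br x z. Proof. exact: linearNl. Qed.
Lemma brNr x z : br x (- z) = - br x z. Proof. exact: linearNr. Qed.

Lemma left_alia_comm (x y z : A) :
  br (comm x y) z + br (comm y z) x + br (comm z x) y = 0.
Proof.
rewrite !(brDl, brNl) (addrACA (br (br x y) z)) (addrACA (_ + _)) -!opprD brA.
by rewrite subrr.
Qed.

(** * The compatibility condition *)

(** Solved for its first term, the left-Alia law absorbs the iterated
commutators that occur in the first slot of [compatE]. *)
Lemma br_comm (x y z : A) :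
  br (comm x y) z = br (comm z y) x - br (comm z x) y.
Proof.
rewrite -[comm z y]opprB [br (- _) x]brNl; apply/eqP.
by rewrite -subr_eq0 opprD !opprK addrA left_alia_comm.
Qed.

Definition compat (x y : A) : 'End(tens2 A) :=
  (h (comm x y) + ((R x \oxm \1) \o h y) - ((R y \oxm \1) \o h x))%VF.

Lemma compatE (x y a b : A) :
  compat x y (a \ox b) =
  br a (comm x y) \ox b - a \ox br b (comm x y)
  - br a x \ox br b y + br a y \ox br b x.
Proof.
rewrite /compat add_lfunE opp_lfunE add_lfunE !comp_lfunE !hmapE.
rewrite !(lfunBr (_ \oxm _)) !tmapE !id_lfunE !rmulE.
rewrite (br_comm x y a) !(tensvBl (br a (comm x y))).
rewrite (tensvBl (br (comm a y) x)).
(* A linear relation between six tensors, read off entry by entry. *)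
move: (br a _ \ox b) (br _ x \ox b) (br _ y \ox b) (a \ox _) => X P Q Y.
move: (_ \ox _) (_ \ox _) => Z T.
apply/matrixP=> i j; rewrite !mxE; ring.
Qed.

(** In [compatE], exchanging a with b and the two slots permutes the four terms
in pairs of opposite sign. *)
Lemma compat_tau (x y : A) (r : tens2 A) :
  compat x y (tau r) = - tau (compat x y r).
Proof.
pose f : 'End(tens2 A) := (compat x y \o tau)%VF.
pose g : 'End(tens2 A) := (- (tau \o compat x y))%VF.
suff /lfunP/(_ r) : f = g by rewrite opp_lfunE !comp_lfunE.
apply: tens_ext => a b; rewrite opp_lfunE !comp_lfunE tswapE !compatE.
rewrite lfunDr !lfunBr !tswapE.
by rewrite !opprD !opprK [RHS](AC (4) (2*1*4*3)).
Qed.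

Lemma tauK : involutive (@tau K A).
Proof.
move=> t; suff /lfunP/(_ t) : (tau \o tau)%VF = \1%VF :> 'End(tens2 A).
  by rewrite comp_lfunE id_lfunE.
by apply: tens_ext => a b; rewrite comp_lfunE id_lfunE !tswapE.
Qed.

Lemma tau_rmul (x : A) (t : tens2 A) :
  (\1%VF \oxm R x) (tau t) = tau ((R x \oxm \1%VF) t).
Proof.
pose f : 'End(tens2 A) := ((\1 \oxm R x) \o tau)%VF.
pose g : 'End(tens2 A) := (tau \o (R x \oxm \1))%VF.
suff /lfunP/(_ t) : f = g by rewrite !comp_lfunE.
by apply: tens_ext => a b; rewrite !comp_lfunE tmapE !tswapE tmapE.
Qed.

Lemma compat_symmetric_part (x y : A) (r : tens2 A) :
  let s := r + tau r in
  (tau - \1%VF) (h (comm x y) r + (R x \oxm \1%VF) (h y r)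
                 - (R y \oxm \1%VF) (h x r))
  = tau (h (comm x y) s) - (\1%VF \oxm R y) (tau (h x s))
    + (\1%VF \oxm R x) (tau (h y s)).
Proof.
move=> s; rewrite !tau_rmul [RHS]addrAC -(lfunDr tau) -(lfunBr tau).
have E t : h (comm x y) t + (R x \oxm \1%VF) (h y t)
    - (R y \oxm \1%VF) (h x t) = compat x y t.
  by rewrite /compat add_lfunE opp_lfunE add_lfunE !comp_lfunE.
rewrite !E /s lfunDr compat_tau lfunBr add_lfunE opp_lfunE id_lfunE.
by rewrite tauK.
Qed.

(** * The co-Jacobi condition, one pair of pure tensors at a time *)

Lemma cycE (x y z : A) :
  cyc (x \ox y \ox z) = x \ox y \ox z + y \ox z \ox x + z \ox x \ox y.
Proof. by rewrite !add_lfunE id_lfunE comp_lfunE !xiE. Qed.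

Lemma tau_idB (y z w : A) :
  (tau \oxm \1%VF - \1%VF) (y \ox z \ox w) = z \ox y \ox w - y \ox z \ox w.
Proof. by rewrite add_lfunE opp_lfunE tmapE !id_lfunE tswapE. Qed.

(** The variable p stands for the commutator of u and x. Keeping it as an
independent variable prevents its expansion while the operators act. *)
Definition coJacobi_term (x p u v : A) (r : tens2 A) : V3 :=
  (tau \oxm \1%VF - \1%VF) (h p r \ox v - h u r \ox br v x).

Definition Al_term (a b u v : A) : V3 :=
  br a u \ox b \ox v + a \ox comm u b \ox v - a \ox u \ox br v b.

Definition symmetric_term (x p u v : A) (s : tens2 A) : V3 :=
  h p s \ox v
  + tau (h u s) \ox br v x
  + tassocV A A A (v \ox (R u \oxm \1%VF) (h x s))
  + (\1%VF \oxm R v \oxm R x) (tassocV A A A (u \ox s))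
  + (\1%VF \oxm R u \oxm R x) (tassocV A A A (v \ox s)).

(** The part of the total contribution of the pair (a (x) b, u (x) v) that does
not cancel by itself, but against the contribution of (u (x) v, a (x) b). *)
Definition residue (x a b u v : A) : V3 :=
  v \ox br b x \ox br a u + u \ox br a v \ox br b x + u \ox br b v \ox br a x
  + b \ox v \ox br (comm a x) u.

Lemma coJacobi_termD (x p u v : A) :
  {morph coJacobi_term x p u v : s t / s + t}.
Proof.
move=> s t; rewrite /coJacobi_term !(lfunDr (h _)) !tensvDl -lfunDr.
by rewrite opprD addrACA.
Qed.

Lemma symmetric_termD (x p u v : A) :
  {morph symmetric_term x p u v : s t / s + t}.
Proof.
move=> s t; rewrite /symmetric_term !(lfunDr (h _)) tensvDl.
rewrite (lfunDr tau) tensvDl (lfunDr (R u \oxm _)) !(tensvDr _ (_ : tens2 A)).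
rewrite !(lfunDr (tassocV _ _ _)) !(lfunDr (_ \oxm _ \oxm _)).
by rewrite [LHS](AC (2*2*2*2*2) ((1*3*5*7*9)*(2*4*6*8*10))).
Qed.

Lemma coJacobi_termE (x p u v a b : A) :
  coJacobi_term x p u v (a \ox b) =
  (b \ox comm a p \ox v - comm a p \ox b \ox v)
  - (br b p \ox a \ox v - a \ox br b p \ox v)
  - (b \ox comm a u \ox br v x - comm a u \ox b \ox br v x
     - (br b u \ox a \ox br v x - a \ox br b u \ox br v x)).
Proof.
rewrite /coJacobi_term !hmapE !(tensvBl (_ \ox _)) lfunBr.
by rewrite (lfunBr _ (_ \ox v)) (lfunBr _ (_ \ox br v x)) !tau_idB.
Qed.

Lemma symmetric_termE (x p u v a b : A) :
  symmetric_term x p u v (a \ox b) =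
  (comm a p \ox b \ox v - a \ox br b p \ox v)
  + (b \ox comm a u \ox br v x - br b u \ox a \ox br v x)
  + (v \ox br (comm a x) u \ox b - v \ox br a u \ox br b x)
  + u \ox br a v \ox br b x + v \ox br a u \ox br b x.
Proof.
rewrite /symmetric_term !hmapE !lfunBr !tswapE !tmapE !id_lfunE !rmulE.
rewrite !(tensvBl (_ \ox _)) (tensvBr v (_ \ox _)) lfunBr !tassocVE.
by rewrite !tmapE !id_lfunE !rmulE.
Qed.

Lemma Al_termE (x a b u v : A) :
  (\1%VF \oxm \1%VF \oxm R x) (id_tau (Al_term a b u v)) =
  br a u \ox v \ox br b x + a \ox v \ox br (comm u b) x
  - a \ox br v b \ox br u x.
Proof.
rewrite /Al_term !lfunBr !lfunDr !id_tauE !tmapE !id_lfunE.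
by rewrite !rmulE.
Qed.

(** The third slots next to a (x) v are br (comm u b) x, - br (comm u x) b and
br (comm b x) u: the left-Alia law removes them. All other terms outside
the two residues cancel by rotating the three slots. *)
Lemma pair_defect (x a b u v : A) :
  cyc (coJacobi_term x (comm u x) u v (a \ox b)
       + ((\1%VF \oxm \1%VF \oxm R x) (id_tau (Al_term a b u v))
          + symmetric_term x (comm u x) u v (a \ox b + b \ox a)))
  = cyc (residue x a b u v) - cyc (residue x u v a b).
Proof.
pose alia := br (comm b u) x + br (comm u x) b + br (comm x b) u.
have alia0 : cyc (a \ox v \ox alia) = 0.
  by rewrite /alia left_alia_comm tensv0r linear0.
rewrite -[LHS]addr0 -alia0 /alia symmetric_termD.
apply/matrixP=> k l.
have addE (s t : V3) : (s + t) k l = s k l + t k l by rewrite mxE.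
have oppE (s : V3) : (- s) k l = - s k l by rewrite mxE.
(* Each F (y (x) z (x) w) becomes the sum of the three rotations of psi, which
   makes the invariance of F under rotation visible to ring. *)
pose psi (y z w : A) : K := (y \ox z \ox w) k l.
pose F (t : V3) : K := cyc t k l.
have FD s t : F (s + t) = F s + F t by rewrite /F lfunDr addE.
have FN s : F (- s) = - F s by rewrite /F lfunNr oppE.
have FE y z w : F (y \ox z \ox w) = psi y z w + psi z w y + psi w y z.
  by rewrite /F cycE !addE.
have psiD1 y y' z w : psi (y + y') z w = psi y z w + psi y' z w.
  by rewrite /psi !tensvDl addE.
have psiD2 y y' z w : psi z (y + y') w = psi z y w + psi z y' w.
  by rewrite /psi tensvDr tensvDl addE.
have psiD3 y y' z w : psi z w (y + y') = psi z w y + psi z w y'.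
  by rewrite /psi tensvDr addE.
have psiN1 y z w : psi (- y) z w = - psi y z w.
  by rewrite /psi !tensvNl oppE.
have psiN2 y z w : psi z (- y) w = - psi z y w.
  by rewrite /psi tensvNr tensvNl oppE.
have psiN3 y z w : psi z w (- y) = - psi z w y.
  by rewrite /psi tensvNr oppE.
rewrite addE [RHS]addE oppE -!/(F _).
rewrite coJacobi_termE Al_termE !symmetric_termE /residue.
rewrite !(FD, FN) !FE.
clearbody psi F.
rewrite !(brDl, brDr, brNl, brNr) !(psiD1, psiD2, psiD3, psiN1, psiN2, psiN3).
ring.
Qed.

(** * Summation over all pairs *)

Section Sum.
Variables (n : nat) (u v : 'I_n -> A).
Let r : tens2 A := \sum_i u i \ox v i.

Lemma symmetrizationE : r + tau r = \sum_i (u i \ox v i + v i \ox u i).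
Proof.
rewrite big_split /= (morphD_sum _ (lfunDr tau)).
by congr (_ + _); apply: eq_bigr => i _; rewrite tswapE.
Qed.

Lemma coJacobi_sum (x : A) :
  (tau \oxm \1%VF - \1%VF) ((delta br r \oxm \1%VF) (delta br r x)) =
  \sum_j \sum_i
    coJacobi_term x (comm (u j) x) (u j) (v j) (u i \ox v i).
Proof.
rewrite (deltaE _ _ x) {2}/r !(morphD_sum _ (lfunDr _)).
apply: eq_bigr => j _; rewrite hmapE lfunBr !tmapE !deltaE !id_lfunE.
by rewrite -(morphD_sum _ (coJacobi_termD _ _ _ _)).
Qed.

Lemma obstruction_sum (x : A) :
  let s := r + tau r in
  (\1%VF \oxm \1%VF \oxm R x) (id_tau (Al br u v))
  + \sum_j symmetric_term x (comm (u j) x) (u j) (v j) s =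
  \sum_j \sum_i
    ((\1%VF \oxm \1%VF \oxm R x) (id_tau (Al_term (u i) (v i) (u j) (v j)))
     + symmetric_term x (comm (u j) x) (u j) (v j)
         (u i \ox v i + v i \ox u i)).
Proof.
move=> s; rewrite /s symmetrizationE /Al exchange_big /=.
rewrite !(morphD_sum _ (lfunDr _)) -big_split; apply: eq_bigr => j _ /=.
rewrite !(morphD_sum _ (lfunDr _)) (morphD_sum _ (symmetric_termD _ _ _ _)).
by rewrite -big_split.
Qed.

Lemma cyc_coJacobi (x : A) :
  let s := r + tau r in
  cyc ((tau \oxm \1%VF - \1%VF) ((delta br r \oxm \1%VF) (delta br r x))) =
  - cyc ((\1%VF \oxm \1%VF \oxm R x) (id_tau (Al br u v))
         + \sum_j symmetric_term x (comm (u j) x) (u j) (v j) s).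
Proof.
move=> s; apply/eqP; rewrite -addr_eq0 -lfunDr coJacobi_sum obstruction_sum.
rewrite -big_split (morphD_sum _ (lfunDr _)) /=.
under eq_bigr => j _.
  rewrite -big_split (morphD_sum _ (lfunDr _)) /=.
  under eq_bigr => i _ do rewrite pair_defect.
  rewrite sumrB.
  over.
by rewrite sumrB [X in _ - X]exchange_big subrr.
Qed.

End Sum.
End AliaCoalgebra.

Theorem proposition4p2
    (K : closedFieldType) (charK0 : [pchar K] =i pred0)
    (A : vectType K) (br : {bilinear A -> A -> A}) (brA : left_alia br)
    (n : nat) (u v : 'I_n -> A) :
  let r : tens2 A := \sum_i u i \ox v i in
  let s : tens2 A := r + tau r in
  let h := hmap br in
  let R := rmul br in
  (forall x : A,
     cyc ((tau \oxm \1%VF - \1%VF) ((delta br r \oxm \1%VF) (delta br r x))) = 0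
     <->
     cyc ((\1%VF \oxm \1%VF \oxm R x) (id_tau (Al br u v))
          + \sum_j
              (h (br (u j) x - br x (u j)) s \ox v j
               + tau (h (u j) s) \ox br (v j) x
               + tassocV A A A (v j \ox (R (u j) \oxm \1%VF) (h x s))
               + (\1%VF \oxm R (v j) \oxm R x) (tassocV A A A (u j \ox s))
               + (\1%VF \oxm R (u j) \oxm R x) (tassocV A A A (v j \ox s))))
     = 0)
  /\
  (forall x y : A,
     (tau - \1%VF) (delta br r (br x y - br y x)
                    + (R x \oxm \1%VF) (delta br r y)
                    - (R y \oxm \1%VF) (delta br r x)) = 0
     <->
     tau (h (br x y - br y x) s)
     - (\1%VF \oxm R y) (tau (h x s))
     + (\1%VF \oxm R x) (tau (h y s)) = 0).
Proof.
move=> r s h R; split=> [x|x y]; last first.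
  by rewrite !deltaE (compat_symmetric_part brA).
rewrite (cyc_coJacobi brA).
split=> E; last by apply/eqP; rewrite oppr_eq0; apply/eqP.
by apply: oppr_inj; rewrite oppr0.
Qed.
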